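(* Let $M$ be a multi-path matroid and $F$ a proper flat of $M$ (a flat different from the whole ground set). Then the restriction $M|F$ is a lattice path matroid.
   Context: Transversal matroid $M[\mathcal{A}]$ of a multiset $\mathcal{A}$ of subsets of a finite set $S$: its independent sets are the partial transversals of $\mathcal{A}$. For a cyclic permutation $\sigma$ of $S$, a $\sigma$-interval is a nonempty set $\{f,\sigma(f),\ldots,l\}$. A multi-path matroid is a transversal matroid with a presentation by an antichain (no member containing another) of $\sigma$-intervals for some cyclic permutation $\sigma$ of its ground set. A lattice path matroid is a matroid isomorphic to $M[P,Q]$ for lattice paths $P,Q$ from $(0,0)$ to $(m,r)$ with $P$ never above $Q$, where $M[P,Q]$ is the transversal matroid on $[m+r]$ presented by $(N_1,\ldots,N_r)$, $N_i$ being the set of $j$ such that the $j$-th step of some lattice path from $(0,0)$ to $(m,r)$ staying weakly between $P$ and $Q$ is its $i$-th North step (equivalently, a transversal matroid with a presentation by an antichain of intervals in a linear order on its ground set). The empty matroid is regarded as a lattice path matroid. *)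

(* Defs.v *)
From mathcomp Require Import all_boot all_fingroup.

Set Implicit Arguments.
Unset Strict Implicit.
Unset Printing Implicit Defensive.

(* The ground set of a matroid is the whole finite type T. *)
Record matroid (T : finType) := Matroid {
  indep : pred {set T};
  indep0 : indep set0;
  indepS : forall I J : {set T}, J \subset I -> indep I -> indep J;
  indep_aug : forall I J : {set T}, indep I -> indep J -> #|I| < #|J| ->
    exists2 x, x \in J :\: I & indep (x |: I) }.

Definition mrank (T : finType) (M : matroid T) (X : {set T}) : nat :=
  \max_(I : {set T} | (I \subset X) && indep M I) #|I|.

Definition mclosure (T : finType) (M : matroid T) (X : {set T}) : {set T} :=
  [set e | mrank M (e |: X) == mrank M X].

Definition flat (T : finType) (M : matroid T) (F : {set T}) : bool :=
  mclosure M F == F.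

Section Restriction.
Variables (T : finType) (M : matroid T) (F : {set T}).

Definition restr_indep (X : {set {x : T | x \in F}}) : bool :=
  indep M (val @: X).

Lemma restr_indep0 : restr_indep set0.
Proof. by rewrite /restr_indep imset0 indep0. Qed.

Lemma restr_indepS (I J : {set {x : T | x \in F}}) :
  J \subset I -> restr_indep I -> restr_indep J.
Proof. by move=> sJI; apply: indepS; apply: imsetS. Qed.

Lemma restr_indep_aug (I J : {set {x : T | x \in F}}) :
  restr_indep I -> restr_indep J -> #|I| < #|J| ->
  exists2 x, x \in J :\: I & restr_indep (x |: I).
Proof.
move=> iI iJ ltIJ.
have [|_ /setDP[/imsetP[x Jx ->] nIx] ixI] := indep_aug iI iJ.
  by rewrite !card_imset //; apply: val_inj.
exists x; last by rewrite /restr_indep imsetU1.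
by rewrite inE Jx andbT; apply: contra nIx; apply: imset_f.
Qed.

(* The matroid M|F; its ground set F is realised as a subtype of T. *)
Definition restriction : matroid {x : T | x \in F} :=
  Matroid restr_indep0 restr_indepS restr_indep_aug.
End Restriction.

Definition isomorphic (T1 T2 : finType) (M1 : matroid T1) (M2 : matroid T2) :=
  exists2 f : T1 -> T2, bijective f &
    forall X : {set T1}, indep M2 (f @: X) = indep M1 X.

Section Transversal.
Variables (T : finType) (r : nat) (A : 'I_r -> {set T}).

Definition matches (X : {set T}) (f : T -> option 'I_r) : Prop :=
  {in X &, injective f} /\
  {in X, forall x, exists2 i, f x = Some i & x \in A i}.

(* X is matched injectively into the index set of the family A.  The values
   are optional because T -> 'I_0 may be empty, whereas set0 is always a
   partial transversal. *)
Definition partial_transversal (X : {set T}) : bool :=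
  [exists f : {ffun T -> option 'I_r},
     dinjectiveb f X
     && [forall x in X, [exists i, (f x == Some i) && (x \in A i)]]].

Lemma partial_transversalP (X : {set T}) :
  reflect (exists f, matches X f) (partial_transversal X).
Proof.
apply: (iffP existsP) => [[f /andP[/dinjectiveP injf /forall_inP Af]]|].
  by exists f; split=> // x /Af/existsP[i /andP[/eqP fx Ax]]; exists i.
case=> f [injf Af]; exists (finfun f); apply/andP; split.
  by apply/dinjectiveP => x y Xx Xy; rewrite !ffunE; apply: injf.
apply/forall_inP => x /Af[i fx Ax]; apply/existsP; exists i.
by rewrite ffunE fx eqxx.
Qed.

Lemma partial_transversal0 : partial_transversal set0.
Proof.
apply/partial_transversalP; exists (fun=> None).
by split=> [x y|x]; rewrite inE.
Qed.

Lemma partial_transversalS (I J : {set T}) :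
  J \subset I -> partial_transversal I -> partial_transversal J.
Proof.
move=> /subsetP sJI /partial_transversalP[f [injf Af]].
apply/partial_transversalP; exists f; split.
  by move=> x y /sJI Ix /sJI Iy; apply: injf.
by move=> x /sJI /Af.
Qed.

Lemma partial_transversal_aug (I J : {set T}) :
  partial_transversal I -> partial_transversal J -> #|I| < #|J| ->
  exists2 x, x \in J :\: I & partial_transversal (x |: I).
Proof.
move=> /partial_transversalP[f mf] /partial_transversalP[g [injg Ag]] ltIJ.
pose D (h : T -> option 'I_r) := [set x in I | h x != g x].
have [k] := ubnP #|D f|; elim: k f mf => // k IHk f [injf Af] ltDk.
have /subsetPn[_ /imsetP[y Jy ->] nfgy] : ~~ (g @: J \subset f @: I).
  apply: contraL ltIJ => /subset_leq_card; rewrite !card_in_imset //.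
  by rewrite -leqNgt.
have nfI x : x \in I -> f x <> g y.
  by move=> Ix fxgy; rewrite -fxgy imset_f in nfgy.
pose h x := if x == y then g y else f x.
have mh : matches (y |: I) h.
  split=> [x z|x]; rewrite !inE /h.
    case: (eqVneq x y) => [->|_] /=; case: (eqVneq z y) => [->|_] //= Ix Iz.
    - by move/esym => /(nfI _ Iz).
    - by move=> /(nfI _ Ix).
    - exact: injf.
  by case: (eqVneq x y) => [-> _|_ /=]; [apply: Ag|apply: Af].
case: (boolP (y \in I)) => Iy; last first.
  exists y; first by rewrite inE Iy.
  by apply/partial_transversalP; exists h.
apply: (IHk h); first by move: mh; rewrite (setUidPr _) // sub1set.
rewrite ltnS in ltDk; apply: leq_trans ltDk; apply/proper_card/properP; split.
  apply/subsetP=> x; rewrite !inE /h.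
  by case: (eqVneq x y) => [->|_] //; rewrite eqxx andbF.
exists y; rewrite !inE Iy /h ?eqxx //=.
by apply/eqP; apply: nfI.
Qed.

Definition transversal_matroid : matroid T :=
  Matroid partial_transversal0 partial_transversalS partial_transversal_aug.
End Transversal.

Definition presentation (T : finType) (M : matroid T)
    (r : nat) (A : 'I_r -> {set T}) : Prop :=
  indep M =1 indep (transversal_matroid A).

Definition antichain (T : finType) (r : nat) (A : 'I_r -> {set T}) : Prop :=
  forall i j, i != j -> ~~ (A i \subset A j).

(* A single cycle through all of T. *)
Definition cyclic_perm (T : finType) (s : {perm T}) : Prop :=
  forall x y, y \in porbit s x.

(* The interval {f, s f, ..., l}. *)
Definition cyclic_interval (T : finType) (s : {perm T}) (f l : T) : {set T} :=
  [set x in traject s f (findex s f l).+1].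

Definition multi_path (T : finType) (M : matroid T) : Prop :=
  exists (s : {perm T}) (r : nat) (A : 'I_r -> {set T}),
    [/\ cyclic_perm s,
        forall i, exists f l, A i = cyclic_interval s f l,
        antichain A
      & presentation M A].

(* A lattice path is the sequence of its steps: true is North, false is East. *)
Definition path_to (m r : nat) (p : (m + r).-tuple bool) : bool :=
  count_mem true p == r.

Definition height (p : seq bool) (k : nat) : nat := count_mem true (take k p).

(* After k steps both paths are on the antidiagonal x + y = k, so p is never
   above q when its height there is at most that of q, for every k. *)
Definition never_above (n : nat) (p q : n.-tuple bool) : bool :=
  [forall k : 'I_n.+1, height p k <= height q k].

(* Indices are shifted to start from 0: j is in the i-th set when step j of
   some path is North and is preceded by exactly i North steps. *)
Definition north_set (m r : nat) (P Q : (m + r).-tuple bool) (i : 'I_r) :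
    {set 'I_(m + r)} :=
  [set j | [exists p : (m + r).-tuple bool,
     [&& path_to p, never_above P p, never_above p Q,
         tnth p j == true & height p j == i]]].

Definition path_matroid (m r : nat) (P Q : (m + r).-tuple bool) :
    matroid 'I_(m + r) :=
  transversal_matroid (north_set P Q).

(* With m = r = 0 this includes the empty matroid. *)
Definition lattice_path (T : finType) (M : matroid T) : Prop :=
  exists (m r : nat) (P Q : (m + r).-tuple bool),
    [/\ path_to P, path_to Q, never_above P Q
      & isomorphic M (path_matroid P Q)].

(* Main.v *)
Require Import Defs.
From mathcomp Require Import all_boot all_fingroup.
From mathcomp Require Import zify.

(** Let the antichain (A i) of cyclic intervals present M.  Fix a maximum
matching of F and let U be the set of indices reachable by alternating paths
from an unmatched index; U is nonempty because F is a proper flat.  Every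
element of C, the part of F covered by the A i with i in U, is a coloop of M|F,
and M|(F \ C) is presented by the A j with j outside U, all of which are used by
the matching.  Now F \ C avoids some A i0 with i0 in U, and the antichain
condition makes every A j an interval of the linear order left after deleting
A i0, with left and right ends increasing together.  Order F by this linear
order, with C last.  Hall's condition for such a system only involves intervals,
and it is implied by |X cap [x, y]| <= rk(.., y] + rk[x, ..) - rk F, which
conversely holds for independent X by submodularity.  This inequality also
characterises independence in M[P, Q], where Q has height rk of the first k
elements after k steps, and P has height rk F minus rk of the other elements. *)

Set Implicit Arguments.
Unset Strict Implicit.
Unset Printing Implicit Defensive.

(** * Counting along an injective key, and greedy matching *)

Lemma card_le_range (S : finType) (I : {set S}) (g : S -> nat) (a b : nat) :
  {in I &, injective g} -> {in I, forall x, a <= g x < b} -> #|I| <= b - a.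
Proof.
move=> g_inj g_ran; rewrite -(size_iota a (b - a)) cardE -(size_map g).
apply: uniq_leq_size.
  rewrite map_inj_in_uniq ?enum_uniq // => x y.
  by rewrite !mem_enum; apply: g_inj.
move=> y /mapP[x]; rewrite mem_enum => /g_ran ran ->.
by rewrite mem_iota; lia.
Qed.

Section CountingRank.
Variables (S : finType) (D : {set S}) (key : S -> nat).
Hypothesis key_inj : {in D &, injective key}.

(** This turns an arbitrary key into consecutive numbers from 0. It numbers the steps of the lattice
    paths and, later, the indices in [V]. *)
Definition count_below (x : S) : nat := #|[set y in D | key y < key x]|.

Lemma count_below_homo x y : key x <= key y -> count_below x <= count_below y.
Proof.
move=> le_xy; apply/subset_leq_card/subsetP => z; rewrite !inE.
by case/andP=> -> /leq_trans ->.
Qed.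

Lemma count_below_ltn x y : x \in D -> key x < key y ->
  count_below x < count_below y.
Proof.
move=> Dx lt_xy; apply/proper_card/properP; split.
  apply/subsetP => z; rewrite !inE => /andP[-> lt_zx] /=; lia.
by exists x; rewrite !inE ?Dx ?ltnn.
Qed.

Lemma count_below_leq x y : y \in D ->
  (count_below x <= count_below y) = (key x <= key y).
Proof.
move=> Dy; apply/idP/idP; last exact: count_below_homo.
by apply: contraLR; rewrite -!ltnNge; apply: count_below_ltn.
Qed.

Lemma count_below_inj : {in D &, injective count_below}.
Proof.
move=> x y Dx Dy /eqP; rewrite eqn_leq !count_below_leq // -eqn_leq.
by move=> /eqP; apply: key_inj.
Qed.

Lemma count_below_max x : x \in D -> count_below x < #|D|.
Proof.
move=> Dx; apply/proper_card/properP; split.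
  by apply/subsetP => z; rewrite inE => /andP[].
by exists x; rewrite // inE ltnn andbF.
Qed.

Lemma count_below_onto k : k < #|D| -> exists2 x, x \in D & count_below x = k.
Proof.
move=> ltk.
have : k \in [seq count_below x | x <- enum D].
  have us : uniq [seq count_below x | x <- enum D].
    rewrite map_inj_in_uniq ?enum_uniq // => x y.
    by rewrite !mem_enum; apply: count_below_inj.
  have sub : {subset [seq count_below x | x <- enum D] <= iota 0 #|D|}.
    move=> y /mapP[x]; rewrite mem_enum => Dx ->.
    by rewrite mem_iota /= add0n count_below_max.
  have [|_ ->] := uniq_min_size us sub; last by rewrite mem_iota.
  by rewrite size_map size_iota -cardE.
by case/mapP=> x; rewrite mem_enum => Dx ->; exists x.
Qed.
End CountingRank.

(* The greedy choice: g y is the least value allowed by lo y and by the values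
   already given to the elements before y. *)
Lemma greedy_matching (S : finType) (Y : {set S}) (pos lo hi : S -> nat) :
    {in Y &, injective pos} ->
    {in Y &, forall x y, pos x <= pos y ->
      lo x + #|[set z in Y | pos x <= pos z <= pos y]| <= hi y} ->
  exists2 g : S -> nat, {in Y &, injective g} &
    {in Y, forall y, lo y <= g y < hi y}.
Proof.
move=> pos_inj hall.
pose seg x y := [set z in Y | pos x <= pos z < pos y].
(* The greedy recursion in closed form: starting from [lo x], each element from x on uses up one
   more value. *)
pose g y := \max_(x in Y | pos x <= pos y) (lo x + #|seg x y|).
have seg_last x y : y \in Y -> pos x <= pos y ->
    #|[set z in Y | pos x <= pos z <= pos y]| = (#|seg x y|).+1.
  move=> Yy le_xy; rewrite (cardsD1 y) inE Yy le_xy leqnn /= add1n; congr _.+1.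
  apply: eq_card => z; rewrite !inE ltn_neqAle.
  case: (boolP (z \in Y)) => [Yz|]; last by rewrite andbF.
  suff -> : (z == y) = (pos z == pos y) by case: eqP => //=; rewrite andbF.
  by apply/eqP/eqP => [-> //|]; apply: pos_inj.
have le_g u y : u \in Y -> pos u <= pos y -> lo u + #|seg u y| <= g y.
  move=> Yu le_uy; pose P x := (x \in Y) && (pos x <= pos y).
  by apply: (@leq_bigmax_cond _ P (fun x => lo x + #|seg x y|)); apply/andP.
(* The u attaining the maximum for x competes for y too, where its segment gains x. *)
have g_lt x y : x \in Y -> y \in Y -> pos x < pos y -> g x < g y.
  move=> Yx Yy lt_xy.
  rewrite /g (bigmax_eq_arg x) ?Yx ?leqnn //.
  case: arg_maxnP => [|u /andP[Yu le_ux] _]; first by rewrite Yx leqnn.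
  apply: leq_trans (le_g u y Yu (leq_trans le_ux (ltnW lt_xy))).
  rewrite -addnS leq_add2l; apply/proper_card/properP; split.
    apply/subsetP => z; rewrite !inE => /andP[-> /andP[-> lt_zx]] /=; lia.
  by exists x; rewrite !inE Yx ?le_ux ?lt_xy ?ltnn ?andbF.
exists g => [x y Yx Yy eq_g|y Yy].
  case: (ltngtP (pos x) (pos y)) => [/g_lt|/g_lt|]; last exact: pos_inj.
    by rewrite eq_g ltnn => /(_ Yx Yy).
  by rewrite eq_g ltnn => /(_ Yy Yx).
apply/andP; split.
  by apply: leq_trans (le_g y y Yy (leqnn _)); apply: leq_addr.
rewrite /g (bigmax_eq_arg y) ?Yy ?leqnn //.
case: arg_maxnP => [|x /andP[Yx le_xy] _]; first by rewrite Yy leqnn.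
by rewrite -addnS -seg_last //; apply: hall.
Qed.

(** * The rank function of a matroid *)

Section Rank.
Variables (T : finType) (M : matroid T).

Lemma card_le_mrank (I X : {set T}) : I \subset X -> indep M I ->
  #|I| <= mrank M X.
Proof.
move=> sIX iI; pose P (J : {set T}) := (J \subset X) && indep M J.
rewrite /mrank -/P; apply: (@leq_bigmax_cond _ P (fun J : {set T} => #|J|)).
exact/andP.
Qed.

Lemma mrank_leq (X : {set T}) k :
  (forall I : {set T}, I \subset X -> indep M I -> #|I| <= k) -> mrank M X <= k.
Proof. by move=> h; apply/bigmax_leqP => I /andP[]; apply: h. Qed.

Lemma mrank_basis (X : {set T}) :
  exists I : {set T}, [/\ I \subset X, indep M I & #|I| = mrank M X].
Proof.
rewrite /mrank (bigmax_eq_arg set0) ?sub0set ?indep0 //.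
case: arg_maxnP => [|I /andP[sIX iI] _]; first by rewrite sub0set indep0.
by exists I.
Qed.

Lemma mrank_mono (X Y : {set T}) : X \subset Y -> mrank M X <= mrank M Y.
Proof.
by move=> sXY; apply: mrank_leq => I sIX; apply/card_le_mrank/(subset_trans sIX).
Qed.

Lemma mrank_leD (X Y : {set T}) : mrank M X <= mrank M Y + #|X :\: Y|.
Proof.
apply: mrank_leq => I sIX iI; rewrite -(cardsID Y I) leq_add //.
  by apply: card_le_mrank; [apply: subsetIr | apply: indepS iI; apply: subsetIl].
by apply/subset_leq_card/setSD.
Qed.

Lemma basis_extension (I X : {set T}) : I \subset X -> indep M I ->
  exists J : {set T}, [/\ I \subset J, J \subset X, indep M J & #|J| = mrank M X].
Proof.
move=> sIX iI; have [k] := ubnP (mrank M X - #|I|).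
elim: k I sIX iI => // k IHk I sIX iI lek.
case: (ltngtP #|I| (mrank M X)) => [lt|gt|eqI]; last by exists I.
  have [K [sKX iK cK]] := mrank_basis X.
  have [|x /setDP[Kx nIx] ixI] := indep_aug iI iK; first by rewrite cK.
  have [| // ||J [sJ sJX iJ cJ]] := IHk (x |: I).
  - by rewrite subUset sub1set sIX (subsetP sKX).
  - by rewrite cardsU1 nIx; lia.
  by exists J; split=> //; apply: subset_trans sJ; apply: subsetUr.
by have := card_le_mrank sIX iI; lia.
Qed.

(** Extend a basis of the intersection to a basis J of the union, and count J inside X and inside
    Y. *)
Lemma mrank_submod (X Y : {set T}) :
  mrank M (X :|: Y) + mrank M (X :&: Y) <= mrank M X + mrank M Y.
Proof.
have [I [sI iI <-]] := mrank_basis (X :&: Y).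
have [|J [sIJ sJ iJ <-]] := basis_extension (_ : I \subset X :|: Y) iI.
  by apply: subset_trans sI _; apply: subset_trans (subsetIl _ _) (subsetUl _ _).
have le Z : #|J :&: Z| <= mrank M Z.
  by apply: card_le_mrank; [apply: subsetIr | apply: indepS iJ; apply: subsetIl].
apply: leq_trans (leq_add (le X) (le Y)).
rewrite -[leqRHS]cardsUI -setIUr setIACA setIid (setIidPl sJ) leq_add2l.
by apply/subset_leq_card; rewrite subsetI sIJ.
Qed.
End Rank.

(** * Lattice paths described by their height functions *)

Definition unit_steps (h : nat -> nat) := forall k, h k <= h k.+1 <= (h k).+1.

Lemma unit_steps_homo h : unit_steps h -> {homo h : i j / i <= j}.
Proof. by move=> hs; apply: homo_leq leqnn leq_trans _ => k; case/andP: (hs k). Qed.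

Definition tuple_of_height n (h : nat -> nat) : n.-tuple bool :=
  [tuple h i.+1 != h i | i < n].

Lemma heightS n (p : n.-tuple bool) (j : 'I_n) :
  height p j.+1 = height p j + tnth p j.
Proof.
rewrite /height (take_nth false) ?size_tuple // -cats1 count_cat /= addn0.
by rewrite (tnth_nth false); case: nth.
Qed.

Lemma height0 p : height p 0 = 0.
Proof. by rewrite /height take0. Qed.

Lemma height_size n (p : n.-tuple bool) : height p n = count_mem true p.
Proof. by rewrite /height take_oversize ?size_tuple. Qed.

Lemma height_tuple n (h : nat -> nat) : unit_steps h -> h 0 = 0 ->
  forall k, k <= n -> height (tuple_of_height n h) k = h k.
Proof.
move=> hs h0; elim=> [|k IHk] ltk; first by rewrite height0 h0.
rewrite (heightS _ (Ordinal ltk)) /= IHk 1?ltnW // tnth_mktuple /=.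
by have := hs k; case: eqP; lia.
Qed.

Lemma path_to_tuple m r (h : nat -> nat) : unit_steps h -> h 0 = 0 ->
  h (m + r) = r -> path_to (tuple_of_height (m + r) h).
Proof. by move=> hs h0 hr; rewrite /path_to -height_size height_tuple // hr. Qed.

Lemma never_aboveP n (p q : n.-tuple bool) :
  reflect (forall k, k <= n -> height p k <= height q k) (never_above p q).
Proof.
apply: (iffP forallP) => h k; last by apply: h; rewrite -ltnS.
by move=> lek; apply: (h (Ordinal (lek : k < n.+1))).
Qed.

(* A path through the required North step is obtained by clamping the height
   function jumping from i to i.+1 at step j between those of P and Q. *)
Lemma north_set_heights m r (hP hQ : nat -> nat) (i : 'I_r) (j : 'I_(m + r)) :
    unit_steps hP -> unit_steps hQ -> hP 0 = 0 -> hQ 0 = 0 ->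
    hP (m + r) = r -> hQ (m + r) = r -> (forall k, hP k <= hQ k) ->
  (j \in north_set (tuple_of_height (m + r) hP) (tuple_of_height (m + r) hQ) i)
    = (hP j <= i < hQ j.+1).
Proof.
move=> sP sQ P0 Q0 Pr Qr lePQ; have ltj := ltn_ord j; rewrite inE.
apply/existsP/idP => [[p /and5P[_ /never_aboveP Pp /never_aboveP pQ]]|hi].
  move=> /eqP pj /eqP hpi.
  have := Pp j (ltnW ltj); have := pQ j.+1 ltj.
  by rewrite heightS pj hpi !height_tuple // ?(ltnW ltj) //; lia.
pose h k := maxn (hP k) (minn (hQ k) (i + (j < k))).
have hs : unit_steps h.
  move=> k; have := sP k; have := sQ k.
  have : (j < k) <= (j < k.+1) <= (j < k).+1 by lia.
  by rewrite /h; lia.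
have h0 : h 0 = 0 by rewrite /h P0 Q0; lia.
have hr : h (m + r) = r by rewrite /h Pr Qr; lia.
have sPj := sP j; have sQj := sQ j.
exists (tuple_of_height (m + r) h); apply/and5P; split.
- exact: path_to_tuple.
- by apply/never_aboveP => k lek; rewrite !height_tuple // /h; lia.
- apply/never_aboveP => k lek; rewrite !height_tuple // /h.
  by have := lePQ k; lia.
- by rewrite tnth_mktuple /h ltnn ltnSn; apply/eqP; lia.
- by rewrite height_tuple // ?(ltnW ltj) // /h ltnn; apply/eqP; lia.
Qed.

(** It is enough to assume that the interval inequality forces independence: the converse holds in
    every matroid by submodularity. The same inequality describes independence in the path matroid,
    so the order-preserving numbering is an isomorphism. *)
Lemma lattice_path_of_order (T : finType) (N : matroid T) (key : T -> nat) :
    injective key ->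
    (forall X : {set T},
      {in X &, forall x y, key x <= key y ->
         #|[set z in X | key x <= key z <= key y]| + mrank N setT
           <= mrank N [set z | key z <= key y] + mrank N [set z | key x <= key z]} ->
      indep N X) ->
  lattice_path N.
Proof.
move=> key_inj indepN.
set r := mrank N setT.
have le_rT : r <= #|T| by apply: mrank_leq => I _ _; apply: max_card.
pose m := #|T| - r.
have mr : m + r = #|T| by rewrite subnK.
pose f := count_below setT key.
have f_le x y : (f x <= f y) = (key x <= key y).
  by apply: count_below_leq; rewrite inE.
have f_inj : injective f.
  move=> x y; apply: count_below_inj; rewrite ?inE //.
  by move=> ? ? _ _; apply: key_inj.
have f_max x : f x < m + r by rewrite mr -cardsT count_below_max ?inE.
pose pre k := [set z | f z < k].
pose suf k := [set z | k <= f z].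
pose hQ k := mrank N (pre k); pose hP k := r - mrank N (suf k).
have card_le1 (D : {set T}) k : {in D, forall z, f z = k} -> #|D| <= 1.
  move=> fD; apply/card_le1_eqP => x y Dx Dy; apply: f_inj.
  by rewrite !fD.
have sQ : unit_steps hQ.
  move=> k; rewrite mrank_mono; last by apply/subsetP => z; rewrite !inE; lia.
  apply: leq_trans (mrank_leD _ _ (pre k)) _; rewrite -[X in _ <= X]addn1 leq_add2l.
  by apply: (card_le1 _ k) => z; rewrite !inE; lia.
have suf_step k : mrank N (suf k.+1) <= mrank N (suf k) <= (mrank N (suf k.+1)).+1.
  rewrite mrank_mono; last by apply/subsetP => z; rewrite !inE; lia.
  apply: leq_trans (mrank_leD _ _ (suf k.+1)) _; rewrite -[X in _ <= X]addn1 leq_add2l.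
  by apply: (card_le1 _ k) => z; rewrite !inE; lia.
have sP : unit_steps hP.
  move=> k; have := suf_step k; rewrite /hP; lia.
have suf_max k : mrank N (suf k) <= r by apply/mrank_mono/subsetT.
have rank_set0 : mrank N set0 = 0.
  apply/eqP; rewrite -leqn0; apply: mrank_leq => I; rewrite subset0 => /eqP -> _.
  by rewrite cards0.
have P0 : hP 0 = 0.
  by rewrite /hP (_ : suf 0 = setT) ?subnn //; apply/setP => z; rewrite !inE.
have Q0 : hQ 0 = 0.
  by rewrite /hQ (_ : pre 0 = set0) //; apply/setP => z; rewrite !inE.
have Pr : hP (m + r) = r.
  rewrite /hP (_ : suf _ = set0) ?rank_set0 ?subn0 //.
  by apply/setP => z; rewrite !inE leqNgt f_max.
have Qr : hQ (m + r) = r.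
  rewrite /hQ (_ : pre _ = setT) //.
  by apply/setP => z; rewrite !inE f_max.
(* As j <= k, the two segments cover the ground set, so their union has rank r. *)
have submod j k : j <= k ->
    r + mrank N (pre k :&: suf j) <= hQ k + mrank N (suf j).
  move=> le_jk; apply: leq_trans (mrank_submod N (pre k) (suf j)).
  rewrite leq_add2r; apply: mrank_mono; apply/subsetP => z _; rewrite !inE; lia.
have lePQ k : hP k <= hQ k.
  by have := submod k k (leqnn k); rewrite /hP; lia.
pose fo x : 'I_(m + r) := Ordinal (f_max x).
have fo_inj : injective fo by move=> x y /(congr1 val); apply: f_inj.
have north i j := @north_set_heights m r _ _ i j sP sQ P0 Q0 Pr Qr lePQ.
exists m, r, (tuple_of_height _ hP), (tuple_of_height _ hQ); split.
- exact: path_to_tuple.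
- exact: path_to_tuple.
- by apply/never_aboveP => k lek; rewrite !height_tuple.
exists fo.
  by apply: inj_card_bij => //; rewrite card_ord mr.
(* If X is matched, the elements of X from x to y use distinct indices between [hP (f x)] and
   [hQ (f y).+1], which is the interval inequality. *)
move=> X; apply/partial_transversalP/idP => [[phi [phi_inj phiA]]|iX].
  apply: indepN => x y Xx Xy le_xy.
  rewrite (_ : [set z | key z <= key y] = pre (f y).+1); last first.
    by apply/setP => z; rewrite !inE ltnS f_le.
  rewrite (_ : [set z | key x <= key z] = suf (f x)); last first.
    by apply/setP => z; rewrite !inE f_le.
  pose I := [set z in X | key x <= key z <= key y].
  pose g z := if phi (fo z) is Some i then val i else 0.
  have phiX z : z \in X -> exists2 i : 'I_r, phi (fo z) = Some i &
      hP (f z) <= i < hQ (f z).+1.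
    move=> Xz; have [i phiz] := phiA (fo z) (imset_f fo Xz).
    by rewrite north => ran; exists i.
  have : #|I| <= hQ (f y).+1 - hP (f x).
    apply: (@card_le_range _ _ g) => [z t|z].
      rewrite !inE => /andP[Xz _] /andP[Xt _]; rewrite /g.
      have [i ez _] := phiX z Xz; have [j et _] := phiX t Xt.
      rewrite ez et => /val_inj eij; apply/fo_inj/phi_inj; rewrite ?imset_f //.
      by rewrite ez et eij.
    rewrite inE -!f_le => /and3P[Xz le_xz le_zy].
    have [i ez ran] := phiX z Xz; rewrite /g ez /=.
    have := unit_steps_homo sP le_xz.
    by have := @unit_steps_homo _ sQ (f z).+1 (f y).+1 le_zy; lia.
  (* Since I is nonempty, the truncated difference bounding its size is a true one. *)
  have : 0 < #|I| by apply/card_gt0P; exists x; rewrite inE Xx leqnn le_xy.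
  by have := suf_max (f x); rewrite /I /hP /hQ; lia.
(* If X is independent, submodularity gives Hall's condition for intervals. The upper end is
   [hQ j.+1] because [north_set] contains j exactly for the indices from [hP j] to just below it. *)
have [||g g_inj g_ran] := @greedy_matching _ (fo @: X) val
    (fun j => hP j) (fun j => hQ j.+1).
- by move=> j k _ _; apply: val_inj.
- move=> _ _ /imsetP[x Xx ->] /imsetP[y Xy ->] /= le_xy.
  set Y := [set _ in _ | _].
  have -> : Y = fo @: (X :&: (pre (f y).+1 :&: suf (f x))).
    apply/setP => j; rewrite inE.
    apply/andP/imsetP => [[/imsetP[z Xz ->] /= /andP[h1 h2]]|[z]].
      by exists z; rewrite // !inE Xz h1 ltnS h2.
    by rewrite !inE ltnS => /and3P[Xz h1 h2] ->; rewrite imset_f //= h1 h2.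
  rewrite card_imset //.
  have : #|X :&: (pre (f y).+1 :&: suf (f x))| <=
      mrank N (pre (f y).+1 :&: suf (f x)).
    by apply: card_le_mrank; [apply: subsetIr|apply: indepS iX; apply: subsetIl].
  have := submod (f x) (f y).+1 (leqW le_xy).
  by have := suf_max (f x); rewrite /hP; lia.
have g_max j : j \in fo @: X -> g j < r.
  move=> Xj; have := g_ran j Xj; have := unit_steps_homo sQ (ltn_ord j).
  by rewrite Qr; lia.
exists (fun j => insub (g j)); split=> [j k Xj Xk|j Xj].
  rewrite !insubT ?g_max // => lj lk [eqg]; exact: g_inj.
exists (Ordinal (g_max j Xj)); first exact: insubT.
by rewrite north; apply: g_ran.
Qed.

(** * Alternating paths and the coloops of a restriction to a proper flat *)

Section FlatDecomposition.
Variables (T : finType) (r : nat) (A : 'I_r -> {set T}).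

(** Since x may already belong to X, this covers both extending a matching and rematching one of its
    elements. *)
Lemma matchesU1 (X : {set T}) f x i : matches A X f -> x \in A i ->
    {in X, forall y, f y != Some i} ->
  matches A (x |: X) (fun y => if y == x then Some i else f y).
Proof.
move=> [f_inj fA] Aix missed; split=> [y z|y]; rewrite !inE.
  case: (eqVneq y x) => [->|_] /=; case: (eqVneq z x) => [->|_] //= Xy Xz.
  - by move/esym => /eqP; rewrite (negPf (missed z Xz)).
  - by move=> /eqP; rewrite (negPf (missed y Xy)).
  - exact: f_inj.
by case: (eqVneq y x) => [-> _|_ /=]; [exists i | apply: fA].
Qed.

(** Along an edge from i to j, some element matched to j can be rematched to i, which frees j. *)
Definition alternating (B : {set T}) (f : T -> option 'I_r) : rel 'I_r :=
  fun i j => [exists x in B, (f x == Some j) && (x \in A i)].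

(* Shifting the matching along the path moves the missed index to its end. *)
Lemma alternating_path_missed (B : {set T}) f i p : matches A B f ->
    {in B, forall y, f y != Some i} ->
    path (alternating B f) i p -> uniq (i :: p) ->
  exists2 g, matches A B g & {in B, forall y, g y != Some (last i p)}.
Proof.
elim: p f i => [|j p IHp] f i mf missed /=; first by exists f.
case/andP=> /exists_inP[x Bx /andP[/eqP fx Aix]] pathp /andP[nip uniqp].
have nij : i != j by move: nip; rewrite inE negb_or => /andP[].
pose f1 y := if y == x then Some i else f y.
have mf1 : matches A B f1.
  by have := matchesU1 mf Aix missed; rewrite (setUidPr _) ?sub1set.
have /andP[njp _] := uniqp; apply: IHp mf1 _ _ uniqp => [y By|].
  rewrite /f1; case: (eqVneq y x) => [_|nyx].
    by apply: contra nij => /eqP[->].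
  apply: contra nyx => /eqP fy; apply/eqP.
  by case: mf => f_inj _; apply: f_inj; rewrite // fy fx.
(* Later edges survive the rematching: only x has changed, and it was matched to j, which does not
   occur again on the path. *)
have sub : {in p, forall l k, alternating B f k l -> alternating B f1 k l}.
  move=> l pl k /exists_inP[y By /andP[/eqP fy Aky]].
  apply/exists_inP; exists y => //; rewrite Aky andbT /f1.
  case: (eqVneq y x) => [eyx|_]; last exact/eqP.
  by move: njp; rewrite -(_ : l = j) ?pl //; move: fx; rewrite -eyx fy => -[].
elim: p j pathp sub {nip njp fx nij} => //= l p IHp j.
case/andP=> ejl pathp sub; rewrite sub ?mem_head //=; apply: IHp => // k pk.
by apply: sub; rewrite inE pk orbT.
Qed.

(** [V] consists of the indices that no alternating path from a missed index reaches. The two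
    conclusions say that the elements of [C] are coloops of the restriction to F, and that a basis
    of F contains [C] and uses every index of [V] outside [C]. *)
Lemma flat_decomposition (M : matroid T) (F : {set T}) :
    presentation M A -> flat M F -> F <> [set: T] ->
  exists2 V : {set 'I_r}, exists i, i \notin V &
    let C := [set x in F | [exists i, (i \notin V) && (x \in A i)]] in
    (forall X : {set T}, X \subset F -> indep M (X :\: C) -> indep M X) /\
    #|V| + #|C| <= mrank M F.
Proof.
move=> pres flatF properF.
have [B [sBF iB cB]] := mrank_basis M F.
have /partial_transversalP[f mf] : partial_transversal A B.
  by rewrite -[partial_transversal A B]pres.
have [f_inj fA] := mf.
pose missed := [set i | [forall x in B, f x != Some i]].
pose U := [set i | [exists k in missed, connect (alternating B f) k i]].
have missedU i : i \in missed -> i \in U.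
  by move=> mi; rewrite inE; apply/exists_inP; exists i.
(* Otherwise shift the missed index to i and match x to it: B together with x would be independent
   in F, although B is a basis. *)
have UB i x : i \in U -> x \in F -> x \in A i -> x \in B.
  rewrite inE => /exists_inP[k mk /connectP[p pathp ->]] Fx Aix.
  have missed_k : {in B, forall y, f y != Some k}.
    by move: mk; rewrite inE => /forall_inP.
  move: Aix; case/shortenP: pathp => q pathq uniqq _ Aix.
  have [g mg missed_g] := alternating_path_missed mf missed_k pathq uniqq.
  apply: contraT => nBx; have : indep M (x |: B).
    rewrite pres; apply/partial_transversalP.
    by eexists; apply: matchesU1 Aix missed_g.
  move/(card_le_mrank (_ : x |: B \subset F)).
  by rewrite subUset sub1set Fx sBF cardsU1 nBx -cB ltnn => /(_ isT).
have fU i x j : i \in U -> x \in B -> x \in A i -> f x = Some j -> j \in U.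
  rewrite !inE => /exists_inP[k mk con] Bx Aix fx.
  apply/exists_inP; exists k => //; apply: connect_trans con (connect1 _).
  by apply/exists_inP; exists x; rewrite // fx eqxx.
exists (~: U).
  (* Adding e outside the flat raises the rank. A matching of the larger independent set needs an
     index that f misses. *)
  have /subsetPn[e _ nFe] : ~~ ([set: T] \subset F).
    by rewrite subTset; apply/eqP.
  have : mrank M (e |: F) != mrank M F.
    by move: nFe; rewrite -{1}(eqP flatF) inE.
  have [I [sI iI cI]] := mrank_basis M (e |: F).
  rewrite neq_ltn ltnNge mrank_mono ?subsetUr //= -cI -cB => ltBI.
  suff [i mi] : exists i, i \in missed by exists i; rewrite inE negbK missedU.
  apply/set0Pn; apply/eqP => missed0.
  have /partial_transversalP[g [g_inj gA]] : partial_transversal A I.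
    by rewrite -[partial_transversal A I]pres.
  have subgf : g @: I \subset f @: B.
    apply/subsetP => _ /imsetP[x Ix ->]; have [i -> _] := gA x Ix.
    have : i \notin missed by rewrite missed0 inE.
    rewrite inE negb_forall_in => /exists_inP[y By].
    by rewrite negbK => /eqP <-; apply: imset_f.
  have := subset_leq_card subgf; rewrite !card_in_imset //.
  by rewrite leqNgt ltBI.
move=> C.
have CP x : x \in C -> exists2 i, i \in U & x \in F /\ x \in A i.
  rewrite inE => /andP[Fx /existsP[i]]; rewrite inE negbK => /andP[Ui Aix].
  by exists i.
have CB x : x \in C -> x \in B by case/CP=> i Ui [Fx Aix]; apply: UB Ui Fx Aix.
have CU x j : x \in C -> f x = Some j -> j \in U.
  by move=> Cx; have [i Ui [_ Aix]] := CP x Cx; apply: fU Ui (CB x Cx) Aix.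
split=> [X sXF|].
  rewrite !pres => /partial_transversalP[g [g_inj gA]].
  have gU x : x \in X :\: C -> exists2 i, g x = Some i & x \in A i /\ i \notin U.
    move=> XCx; have [i gx Aix] := gA x XCx; exists i => //; split=> //.
    have /setDP[Xx] := XCx; rewrite inE (subsetP sXF) //=.
    by apply: contra => Ui; apply/existsP; exists i; rewrite inE negbK Ui.
  (* On [C] the matching f uses only indices in [U], while outside [C] the matching g uses none of
     them, so they combine. *)
  apply/partial_transversalP; exists (fun x => if x \in C then f x else g x).
  split=> [x y Xx Xy|x Xx]; last first.
    case: ifP => [/CB|nC]; first exact: fA.
    by apply: gA; rewrite inE nC.
  case: ifP => Cx; case: ifP => Cy.
  - by apply: f_inj; apply: CB.
  - have [j gy [_ nUj]] := gU y (introT setDP (conj Xy (negbT Cy))).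
    by rewrite gy => /(CU x j Cx); rewrite (negPf nUj).
  - have [j gx [_ nUj]] := gU x (introT setDP (conj Xx (negbT Cx))).
    by rewrite gx => /esym /(CU y j Cy); rewrite (negPf nUj).
  - by apply: g_inj; rewrite inE ?Cx ?Cy.
(* B contains [C], and an index outside [U] is not missed, hence is the match of an element of B,
   which cannot lie in [C]. *)
rewrite -cB -(cardsID C B) addnC leq_add //.
  by apply/subset_leq_card/subsetP => x Cx; rewrite inE CB.
rewrite -(card_imset (mem (~: U)) (@Some_inj _)) -(card_in_imset (f := f)); last first.
  by move=> x y /setDP[Bx _] /setDP[By _]; apply: f_inj.
apply/subset_leq_card/subsetP => _ /imsetP[i nUi ->].
have {}nUi : i \notin U by move: nUi; rewrite in_setC.
have : i \notin missed by apply: contra nUi; apply: missedU.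
rewrite inE negb_forall_in => /exists_inP[x Bx]; rewrite negbK => /eqP fx.
rewrite -fx; apply: imset_f; rewrite inE Bx andbT.
by apply/negP => /CU/(_ fx); apply/negP.
Qed.
End FlatDecomposition.

(** * Positions along a cyclic permutation *)

Section CyclicPosition.
Variables (T : finType) (s : {perm T}).
Hypothesis cyc : cyclic_perm s.

Lemma cyclic_fconnect x y : fconnect s x y.
Proof.
have /porbitP[i ->] := cyc x y.
by rewrite permX; apply: fconnect_iter.
Qed.

Lemma order_cyclic x : fingraph.order s x = #|T|.
Proof. by apply: eq_card => y; rewrite inE cyclic_fconnect. Qed.

Lemma findex_cyclic_max x y : findex s x y < #|T|.
Proof. by rewrite -(order_cyclic x) findex_max ?cyclic_fconnect. Qed.

Lemma findex_cyclic_inj z : injective (findex s z).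
Proof.
move=> x y eq_xy.
by rewrite -(iter_findex (cyclic_fconnect z x)) eq_xy iter_findex ?cyclic_fconnect.
Qed.

Lemma mem_cyclic_interval f l x :
  (x \in cyclic_interval s f l) = (findex s f x <= findex s f l).
Proof.
rewrite inE; apply/trajectP/idP => [[i lti ->]|le_xl].
  rewrite findex_iter // order_cyclic.
  by apply: leq_ltn_trans (findex_cyclic_max f l).
by exists (findex s f x); rewrite ?iter_findex ?cyclic_fconnect.
Qed.

(** Moving the origin from z to f subtracts the position of f modulo [#|T|]; the second branch adds
    the full turn needed when x comes before f. *)
Lemma findex_cyclic_shift z f x :
  findex s f x = if findex s z f <= findex s z x
                 then findex s z x - findex s z f
                 else findex s z x + #|T| - findex s z f.
Proof.
have fE : f = iter (findex s z f) s z by rewrite iter_findex ?cyclic_fconnect.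
have xE : x = iter (findex s z x) s z by rewrite iter_findex ?cyclic_fconnect.
have ltx := findex_cyclic_max z x; have ltf := findex_cyclic_max z f.
have shift k : k < #|T| -> iter (k + findex s z f) s z = x -> findex s f x = k.
  by move=> ltk; rewrite iterD -fE => <-; rewrite findex_iter // order_cyclic.
case: leqP => le; apply: shift; try lia; first by rewrite subnK.
rewrite subnK; last by lia.
by rewrite iterD -(order_cyclic z) iter_order //; apply: perm_inj.
Qed.

(* Positions are counted from z, and the last position of the interval is not
   reduced modulo #|T|, so that it exceeds #|T| when the interval wraps. *)
Lemma mem_cyclic_interval_pos z f l x :
  let e := findex s z f + findex s f l in
  (x \in cyclic_interval s f l) =
  (findex s z f <= findex s z x <= e) || (findex s z x + #|T| <= e).
Proof.
move=> e; rewrite mem_cyclic_interval (findex_cyclic_shift z f x) /e.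
have := findex_cyclic_max f l; have := findex_cyclic_max z x.
have := findex_cyclic_max z f.
by case: (leqP (findex s z f) (findex s z x)); lia.
Qed.
End CyclicPosition.

(** * Restriction of a multi-path matroid to a proper flat *)

Theorem theorem6p3 (T : finType) (M : matroid T) (F : {set T})
    (hM : multi_path M) (hF : flat M F) (hproper : F <> [set: T]) :
  lattice_path (restriction M F).
Proof.
have [s [r [A [cyc interval antiA pres]]]] := hM.
have [V [i0 nVi0] [indepF rankF]] := flat_decomposition pres hF hproper.
set C := [set x in F | _] in indepF rankF.
have [fst fstP] := fin_all_exists interval.
have [lst AE] := fin_all_exists fstP.
set n := #|T|.
(* With positions counted from its first element, [A i0] is an initial segment; it misses [F :\: C]
   because i0 is outside [V]. *)
pose pos := findex s (fst i0).
pose a i := pos (fst i).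
pose e i := a i + findex s (fst i) (lst i).
have memA i x : (x \in A i) = (a i <= pos x <= e i) || (pos x + n <= e i).
  by rewrite AE (mem_cyclic_interval_pos cyc (fst i0)).
have pos_inj : injective pos by apply: findex_cyclic_inj cyc _.
have pos_max x : pos x < n by apply: findex_cyclic_max.
have a0 : a i0 = 0.
  by rewrite /a /pos -[X in findex s _ X]/(iter 0 s (fst i0)) findex_iter ?order_gt0.
have e_max i : e i < a i + n by rewrite ltn_add2l findex_cyclic_max.
(* If [A j] started no earlier and ended no later than [A i], it would be contained in [A i], even
   when wrapping. *)
have e_mono i j : i != j -> a i <= a j -> e i < e j.
  move=> nij le_a; rewrite ltnNge; apply: contra (antiA j i _) => [le_e|].
    by apply/subsetP => x; rewrite !memA; lia.
  by rewrite eq_sym.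
have a_inj : injective a.
  move=> i j eq_a; apply/eqP; apply: contraT => nij.
  have := e_mono i j nij; have := e_mono j i; rewrite eq_sym => /(_ nij).
  by rewrite eq_a leqnn => /(_ isT) lt1 /(_ isT); lia.
(* An A j wrapping past the end of A i0 would contain A i0. *)
have memG x j : x \in F :\: C -> (x \in A j) = (a j <= pos x <= e j).
  move=> /setDP[Fx]; rewrite inE Fx /= => nCx.
  have nA0x : x \notin A i0.
    by apply: contra nCx => A0x; apply/existsP; exists i0; rewrite nVi0.
  suff : ~~ (pos x + n <= e j).
    by rewrite memA; case: (pos x + n <= _); rewrite ?orbF.
  apply/negP => wrap; have [eji|nji] := eqVneq j i0.
    by move: nA0x; rewrite -eji memA wrap orbT.
  apply: (negP (antiA i0 j _)); first by rewrite eq_sym.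
  apply/subsetP => y; have := e_max i0; have := pos_max y.
  by move: nA0x; rewrite !memA a0; lia.
have memV x j : x \in F :\: C -> x \in A j -> j \in V.
  move=> /setDP[Fx]; rewrite inE Fx /= => nCx Ajx.
  by apply: contraR nCx => nVj; apply/existsP; exists j; rewrite nVj.
have card_le_V (I : {set T}) (W : {set 'I_r}) : indep M I ->
    {in I, forall x i, x \in A i -> i \in W} -> #|I| <= #|W|.
  rewrite pres => /partial_transversalP[f [f_inj fA]] IW.
  rewrite -(card_in_imset f_inj) -(card_imset (mem W) (@Some_inj _)).
  apply/subset_leq_card/subsetP => _ /imsetP[x Ix ->].
  by have [i -> Aix] := fA x Ix; apply: imset_f; apply: IW Aix.
(* When [V] is sorted by left ends, hence also by right ends, the sets containing an element x of
   [F :\: C] have the ranks from [lo x] to just below [hi x]. *)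
pose lo x := #|[set j in V | e j < pos x]|.
pose hi x := #|[set j in V | a j <= pos x]|.
(* All positions are below n, so adding n puts [C] last. *)
pose key (z : {x | x \in F}) := pos (val z) + (val z \in C) * n.
have key_inj : injective key.
  move=> y z; rewrite /key => eq_key; apply/val_inj/pos_inj.
  have := pos_max (val y); have := pos_max (val z); move: eq_key.
  by do 2!case: (_ \in C); lia.
have rank_restr : mrank M F <= mrank (restriction M F) setT.
  have [B [sBF iB <-]] := mrank_basis M F.
  have BE : B = val @: [set z : {x | x \in F} | val z \in B].
    apply/setP => x; apply/idP/imsetP => [Bx|[z]]; last by rewrite inE => Bz ->.
    by exists (exist _ x (subsetP sBF x Bx)); rewrite ?inE.
  rewrite {1}BE card_imset; last exact: val_inj.
  by apply: card_le_mrank; rewrite ?subsetT //= /restr_indep -BE.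
apply: (lattice_path_of_order key_inj) => X boundX /=.
rewrite /restr_indep; apply: indepF.
  by apply/subsetP => _ /imsetP[z _ ->]; apply: valP.
set Y := _ :\: C.
have YP y : y \in Y -> exists2 z, z \in X & val z = y /\ y \in F :\: C.
  case/setDP=> /imsetP[z Xz ->] nC; exists z => //; split=> //.
  by rewrite inE nC; apply: valP.
rewrite pres; apply/partial_transversalP.
have [||g g_inj g_ran] := @greedy_matching _ Y pos lo hi.
- by move=> x y _ _; apply: pos_inj.
- move=> x y Yx Yy le_xy.
  have [x' Xx [ex Gx]] := YP x Yx; have [y' Xy [ey Gy]] := YP y Yy.
  have [_ nCx] := setDP Gx; have [_ nCy] := setDP Gy.
  have kx : key x' = pos x by rewrite /key ex (negPf nCx) mul0n addn0.
  have ky : key y' = pos y by rewrite /key ey (negPf nCy) mul0n addn0.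
  have := boundX x' y' Xx Xy; rewrite kx ky => /(_ le_xy).
  set K := [set z in X | _]; set L := [set z | _]; set R := [set z | _].
  have cK : #|[set z in Y | pos x <= pos z <= pos y]| <= #|K|.
    rewrite -(card_imset (mem K) val_inj).
    apply/subset_leq_card/subsetP => z; rewrite inE => /andP[Yz ran].
    have [z' Xz [ez Gz]] := YP z Yz; rewrite -ez; apply: imset_f.
    by rewrite inE Xz /key ez; have [_ /negPf ->] := setDP Gz; rewrite mul0n addn0.
  (* [L] avoids [C], since its keys are at most [pos y], which is below n. In contrast [R] may meet
     [C], which costs the term [#|C|] in the next bound. *)
  have cL : mrank (restriction M F) L <= hi y.
    apply: mrank_leq => I sIL iI; rewrite -(card_imset _ val_inj).
    apply: card_le_V iI _ => _ /imsetP[z Iz ->] j Ajz.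
    have := subsetP sIL z Iz; rewrite inE /key => le_zy.
    have Gz : val z \in F :\: C.
      rewrite inE (valP z) andbT; apply/negP => Cz.
      move: le_zy; rewrite Cz mul1n leqNgt.
      by rewrite (leq_trans (pos_max y)) ?leq_addl.
    rewrite inE (memV _ _ Gz Ajz) /=.
    move: Ajz; rewrite memG // => /andP[le_az _].
    exact: leq_trans le_az (leq_trans (leq_addr _ _) le_zy).
  have cR : mrank (restriction M F) R + lo x <= #|V| + #|C|.
    rewrite -(cardsID [set j | e j < pos x] V).
    rewrite (_ : V :&: _ = [set j in V | e j < pos x]); last first.
      by apply/setP => j; rewrite !inE.
    rewrite addnC -addnA leq_add2l addnC; apply: mrank_leq => I sIR iI.
    rewrite -(card_imset _ val_inj) -(cardsID C (val @: I)) leq_add //.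
      by apply/subset_leq_card/subsetIr.
    apply: card_le_V => [|z /setDP[/imsetP[z' Iz ->] nCz] j Ajz].
      exact: indepS (subsetDl _ _) (iI : indep M (val @: I)).
    have Gz : val z' \in F :\: C by rewrite inE nCz; apply: valP.
    have := subsetP sIR z' Iz; rewrite !inE /key (negPf nCz) mul0n addn0 => le_xz.
    rewrite (memV _ _ Gz Ajz) andbT -leqNgt.
    by move: Ajz; rewrite memG // => /andP[_]; apply: leq_trans.
  (* By [rankF], the terms [#|V| + #|C|] on both sides cancel, leaving Hall's condition. *)
  move=> /(leq_trans (leq_add cK (leq_trans rankF rank_restr))) bound.
  rewrite -(leq_add2r (#|V| + #|C|)) -addnA addnC.
  apply: leq_trans (leq_add bound (leqnn (lo x))) _.
  by rewrite -addnA leq_add.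
pose rho := count_below V a.
have a_injV : {in V &, injective a} by move=> i j _ _; apply: a_inj.
have g_max y : y \in Y -> g y < #|V|.
  move=> Yy; have /andP[_ /leq_trans] := g_ran y Yy; apply.
  by apply/subset_leq_card/subsetP => j; rewrite inE => /andP[].
(* The index i of rank [g y] works: if [A i] began after y, all indices counted by [hi y] would
   precede i; if it ended before y, i and all its predecessors would be counted by [lo y]. Outside
   [Y] the value i0 is a mere default. *)
have pick_index y : exists i, y \in Y -> [/\ i \in V, rho i = g y & y \in A i].
  case: (boolP (y \in Y)) => [Yy|]; last by exists i0.
  have [i Vi rhoi] := count_below_onto a_injV (g_max y Yy).
  exists i => _; split=> //; have [_ _ [_ Gy]] := YP y Yy.
  have /andP[lo_g g_hi] := g_ran y Yy; rewrite memG //; apply/andP; split.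
    rewrite leqNgt; apply: contraTN g_hi => lt_ya; rewrite -leqNgt -rhoi.
    apply/subset_leq_card/subsetP => j; rewrite !inE => /andP[-> le_j] /=.
    exact: leq_ltn_trans le_j lt_ya.
  rewrite leqNgt; apply: contraTN lo_g => lt_ey; rewrite -ltnNge -rhoi.
  apply/proper_card/properP; split.
    apply/subsetP => j; rewrite !inE => /andP[-> lt_ji] /=.
    apply: ltn_trans lt_ey; apply: e_mono (ltnW lt_ji).
    by apply: contraTneq lt_ji => ->; rewrite ltnn.
  by exists i; rewrite !inE Vi ?ltnn.
have [ind indP] := fin_all_exists pick_index.
exists (fun y => Some (ind y)); split=> [x y Yx Yy [eq_i]|y Yy]; last first.
  by have [_ _ Aiy] := indP y Yy; exists (ind y).
have [_ gx _] := indP x Yx; have [_ gy _] := indP y Yy.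
by apply: g_inj; rewrite // -gx -gy eq_i.
Qed.
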